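(* Let $Q$ be a finite connected quiver, $I$ an admissible ideal of $\Bbbk Q$ satisfying the commutativity condition of loops, $A=\Bbbk Q/I$, and let $B=A/J$ be the loop-reduced algebra of $A$. If $B$ is representation-directed, then $$\mathrm{fpdim}(A\text{-mod})=\max_{P\in Q_0} N_P,$$ where $N_P$ is the number of loops at the vertex $P$.
   Context: $\Bbbk$ is an algebraically closed field; $A$-mod denotes the category of finite-dimensional left $A$-modules. A loop is an arrow whose source and target coincide. An admissible ideal $I$ of $\Bbbk Q$ satisfies the commutativity condition of loops if: (a) every path of length two consisting of a loop followed by a non-loop arrow lies in $I$; (b) every path of length two consisting of a non-loop arrow followed by a loop lies in $I$; (c) for any two loops $\gamma_1,\gamma_2$ at the same vertex, $\gamma_1\gamma_2-\gamma_2\gamma_1\in I$. Then $J$ denotes the ideal of $A=\Bbbk Q/I$ generated by all loops, and $B=A/J$ is the loop-reduced algebra. A path in $B$-mod is a sequence $M_0\to M_1\to\cdots\to M_t$ ($t\ge1$) of indecomposable modules and nonzero non-isomorphisms; it is a cycle if $M_0\cong M_t$; $B$ is representation-directed if no indecomposable $B$-module lies on a cycle. Frobenius–Perron dimension: for a $\Bbbk$-linear abelian category $\mathcal C$, an object $M$ is a brick if $\mathrm{Hom}_{\mathcal C}(M,M)=\Bbbk$; a finite set $\phi=\{X_1,\dots,X_n\}$ of nonzero objects is a brick set if every $X_i$ is a brick and $\dim\mathrm{Hom}_{\mathcal C}(X_i,X_j)=\delta_{ij}$ for all $i,j$; its adjacency matrix is $C(\phi)=(\dim \mathrm{Ext}^1_{\mathcal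 C}(X_i,X_j))_{i,j}$; $\rho$ denotes spectral radius (maximum modulus of complex eigenvalues); $\mathrm{fpdim}(\mathcal C)=\sup\{\rho(C(\phi)):\phi \text{ a brick set in }\mathcal C\}$ (taken to be $0$ if there is no brick set). *)

(* Defs.v *)
From HB Require Import structures.
From mathcomp Require Import all_boot all_order all_algebra all_field.
From mathcomp Require Import boolp.
Set Implicit Arguments. Unset Strict Implicit. Unset Printing Implicit Defensive.
Import Order.TTheory GRing.Theory Num.Theory.
Local Open Scope ring_scope.

(* A path is a pair (v, [:: a1; ...; ak]) : start vertex v and the arrows    *)
(* traversed in order a1 first; it is valid when consecutive arrows compose. *)
(* Length-0 paths (v, [::]) are the trivial paths e_v.                        *)
Section Quiver.
Variables (F : closedFieldType) (V Ar : finType) (src tgt : Ar -> V).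

Definition qpath := (V * seq Ar)%type.

Fixpoint chain (v : V) (s : seq Ar) : bool :=
  if s is a :: s' then (src a == v) && chain (tgt a) s' else true.

Definition valid (p : qpath) : bool := chain p.1 p.2.
Definition pend (p : qpath) : V := last p.1 (map tgt p.2).
Definition plen (p : qpath) : nat := size p.2.

Definition qadj : rel V :=
  fun v w => [exists a, ((src a == v) && (tgt a == w)) || ((src a == w) && (tgt a == v))].
Definition connected_quiver : Prop := forall v w : V, connect qadj v w.

Definition is_loop (a : Ar) : bool := src a == tgt a.

(* Elements of the path algebra kQ as formal F-linear combinations of paths *)
Definition kQ := seq (F * qpath).

Definition coef (x : kQ) (p : qpath) : F := \sum_(cp <- x | cp.2 == p) cp.1.
Definition eqkQ (x y : kQ) : Prop := forall p, valid p -> coef x p = coef y p.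

Definition compat (p q : qpath) : bool := valid p && valid q && (pend p == q.1).
Definition mulkQ (x y : kQ) : kQ :=
  flatten [seq [seq (cp.1 * dq.1, (cp.2.1, cp.2.2 ++ dq.2.2))
               | dq <- y & compat cp.2 dq.2] | cp <- x].
Definition scalekQ (c : F) (x : kQ) : kQ := [seq (c * cp.1, cp.2) | cp <- x].
Definition pathkQ (p : qpath) : kQ := [:: (1, p)].

Definition is_ideal (I : kQ -> Prop) : Prop :=
  [/\ forall x y, eqkQ x y -> I x -> I y,
      I [::],
      forall x y, I x -> I y -> I (x ++ y),
      forall c x, I x -> I (scalekQ c x)
    & forall x y, I x -> I (mulkQ x y) /\ I (mulkQ y x)].

(* admissible: R^m ⊆ I ⊆ R^2 for some m >= 2 (R = arrow ideal) *)
Definition admissible (I : kQ -> Prop) : Prop :=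
  [/\ is_ideal I,
      exists2 m : nat, (2 <= m)%N &
        forall p, valid p -> (m <= plen p)%N -> I (pathkQ p)
    & forall x, I x -> forall p, valid p -> (plen p < 2)%N -> coef x p = 0].

Definition loop_comm (I : kQ -> Prop) : Prop :=
  [/\ forall a b, is_loop a -> ~~ is_loop b -> tgt a = src b ->
        I (pathkQ (src a, [:: a; b])),
      forall a b, ~~ is_loop a -> is_loop b -> tgt a = src b ->
        I (pathkQ (src a, [:: a; b]))
    & forall g1 g2, is_loop g1 -> is_loop g2 -> src g1 = src g2 ->
        I [:: (1, (src g1, [:: g1; g2])); (-1, (src g1, [:: g2; g1]))]].

Definition nloops (P : V) : nat := #|[set a | (src a == P) && (tgt a == P)]|.

(* Finite-dimensional modules over A = kQ/I.  A module is F^n (row vectors)  *)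
(* together with the action matrices of the generators e_v and of the arrows *)
(* (row vectors are acted upon on the right: m.(p q) = (m.p).q, paths being  *)
(* traversed a1 first).                                                       *)
Record rep := Rep { rdim : nat; rE : V -> 'M[F]_rdim; rX : Ar -> 'M[F]_rdim }.

Definition pact (M : rep) (p : qpath) : 'M[F]_(rdim M) :=
  foldl (fun A a => A *m rX M a) (rE M p.1) p.2.
Definition act (M : rep) (x : kQ) : 'M[F]_(rdim M) :=
  \sum_(cp <- x) cp.1 *: pact M cp.2.

Definition is_kQmod (M : rep) : Prop :=
  [/\ forall v w, rE M v *m rE M w = if v == w then rE M v else 0,
      \sum_(v : V) rE M v = 1%:M
    & forall a, rX M a = rE M (src a) *m rX M a *m rE M (tgt a)].

Definition is_Amod (I : kQ -> Prop) (M : rep) : Prop :=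
  is_kQmod M /\ forall x, I x -> act M x = 0.

(* B = A/J, J generated by loops: B-modules = A-modules annihilated by loops *)
Definition is_Bmod (I : kQ -> Prop) (M : rep) : Prop :=
  is_Amod I M /\ forall a, is_loop a -> rX M a = 0.

Definition is_hom (M N : rep) (f : 'M[F]_(rdim M, rdim N)) : Prop :=
  (forall v, rE M v *m f = f *m rE N v) /\ (forall a, rX M a *m f = f *m rX N a).

Definition is_iso (M N : rep) (f : 'M[F]_(rdim M, rdim N)) : Prop :=
  is_hom f /\ exists2 g : 'M[F]_(rdim N, rdim M), is_hom g &
    f *m g = 1%:M /\ g *m f = 1%:M.

Definition isomorphic (M N : rep) : Prop := exists f, @is_iso M N f.

(* indecomposable: nonzero, with no nontrivial idempotent endomorphism       *)
(* (equivalently, no nontrivial direct sum decomposition)                     *)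
Definition indecomposable (M : rep) : Prop :=
  (0 < rdim M)%N /\
  forall e : 'M[F]_(rdim M), is_hom e -> e *m e = e -> e = 0 \/ e = 1%:M.

(* dimension of the (linear) subspace of vT cut out by P:                    *)
(* the maximal size of a linearly independent family of elements satisfying P *)
Definition pdim (vT : vectType F) (P : vT -> Prop) : nat :=
  \max_(k < (\dim {: vT}).+1 |
          `[< exists s : k.-tuple vT, free s /\ forall i, P (tnth s i) >]) k.

Definition dimHom (M N : rep) : nat := pdim (fun f : 'M[F]_(rdim M, rdim N) => is_hom f).

(* Ext^1(M, N) via extensions 0 -> N -> E -> M -> 0: E = N (+) M as a vector *)
(* space, generators act by block matrices [[N_g, 0], [D_g, M_g]].  Ext^1 is  *)
(* the space of such D making E an A-module, modulo those obtained from a    *)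
(* split extension by a change of splitting (D_g = g N_g - M_g g).           *)
Definition gen (M : rep) (k : V + Ar) : 'M[F]_(rdim M) :=
  match k with inl v => rE M v | inr a => rX M a end.

Definition ext_rep (M N : rep) (D : {ffun V + Ar -> 'M[F]_(rdim M, rdim N)}) : rep :=
  @Rep (rdim N + rdim M)
       (fun v => block_mx (rE N v) 0 (D (inl v)) (rE M v))
       (fun a => block_mx (rX N a) 0 (D (inr a)) (rX M a)).

Definition dimExt1 (I : kQ -> Prop) (M N : rep) : nat :=
  subn (pdim (fun D : {ffun V + Ar -> 'M[F]_(rdim M, rdim N)} => is_Amod I (ext_rep D)))
   (pdim (fun D : {ffun V + Ar -> 'M[F]_(rdim M, rdim N)} =>
             exists g : 'M[F]_(rdim M, rdim N),
               forall k, D k = g *m gen N k - gen M k *m g)).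

Definition brick_set (I : kQ -> Prop) (n : nat) (X : 'I_n -> rep) : Prop :=
  forall i j, [/\ is_Amod I (X i), (0 < rdim (X i))%N
                & dimHom (X i) (X j) = (i == j)].

Definition adjmx (I : kQ -> Prop) (n : nat) (X : 'I_n -> rep) : 'M[algC]_n :=
  \matrix_(i, j) (dimExt1 I (X i) (X j))%:R.

Definition on_cycle (I : kQ -> Prop) (M : rep) : Prop :=
  exists (t : nat) (Ms : nat -> rep)
         (fs : forall i : nat, 'M[F]_(rdim (Ms i), rdim (Ms i.+1))),
    [/\ (1 <= t)%N,
        forall i, (i <= t)%N -> is_Bmod I (Ms i) /\ indecomposable (Ms i),
        forall i, (i < t)%N -> [/\ is_hom (fs i), fs i != 0 & ~ is_iso (fs i)],
        isomorphic (Ms 0%N) (Ms t)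
      & exists2 i, (i <= t)%N & Ms i = M].

Definition rep_directed_B (I : kQ -> Prop) : Prop :=
  forall M, is_Bmod I M -> indecomposable M -> ~ on_cycle I M.
End Quiver.

Definition cmax (x y : algC) : algC := if x <= y then y else x.
Definition specrad (n : nat) (C : 'M[algC]_n) : algC :=
  foldr cmax 0 [seq `|z| | z <- sval (closed_field_poly_normal (char_poly C))].

(* fpdim(A-mod) = x : x is the supremum (among reals >= 0; 0 if there is no  *)
(* brick set) of the spectral radii of adjacency matrices of brick sets.      *)
Definition is_fpdim_Amod (F : closedFieldType) (V Ar : finType) (src tgt : Ar -> V)
    (I : kQ F V Ar -> Prop) (x : algC) : Prop :=
  [/\ 0 <= x,
      forall n (X : 'I_n -> rep F V Ar), brick_set src tgt I X ->
        specrad (adjmx src tgt I X) <= x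
    & forall y : algC, 0 <= y ->
        (forall n (X : 'I_n -> rep F V Ar), brick_set src tgt I X ->
           specrad (adjmx src tgt I X) <= y) -> x <= y].

(* Main.v *)
(* Because loops commute with each other and annihilate all other arrows, a loop
   acts on any A-module as an endomorphism; being nilpotent, it acts as zero on a
   brick, so bricks are B-modules. The same remark applied to the middle term of
   an extension of X by Y shows that its components on loops are morphisms
   X -> Y. In a brick set they therefore vanish off the diagonal and are scalars
   on it, nonzero only if X is supported at a single vertex P, in which case
   dim Ext^1(X, X) is at most the number of loops at P. All other extensions are
   extensions of B-modules; an indecomposable summand K of a nonsplit one gives a
   path Y -> K -> X, so directedness makes the off-diagonal part of the adjacency
   matrix acyclic. The eigenvalues are then among the diagonal entries. The bound
   is attained by the simple modules, since I contains no relation of length less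
   than 2. *)
Require Import Defs.
From HB Require Import structures.
From mathcomp Require Import all_boot all_order all_algebra all_field.
From mathcomp Require Import boolp.
Set Implicit Arguments.
Unset Strict Implicit.
Unset Printing Implicit Defensive.
Import Order.TTheory GRing.Theory Num.Theory.
Local Open Scope ring_scope.

(** * Dimension of the subspace cut out by a predicate *)

Section PropDimension.
Variables (F : closedFieldType) (vT : vectType F).
Implicit Types P Q : vT -> Prop.

Lemma leq_pdim P k (s : k.-tuple vT) :
  free s -> (forall i, P (tnth s i)) -> (k <= pdim P)%N.
Proof.
move=> fs Ps; have lek : (k < (\dim {: vT}).+1)%N.
  by rewrite ltnS -(size_tuple s) -(eqnP fs) dimvS ?subvf.
by apply: (@bigop.bigmax_sup _ (Ordinal lek)) => //; apply/asboolP; exists s.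
Qed.

Lemma pdim_leq P m :
  (forall k (s : k.-tuple vT), free s -> (forall i, P (tnth s i)) -> (k <= m)%N) ->
  (pdim P <= m)%N.
Proof. by move=> H; apply/bigmax_leqP => k /asboolP[s [fs Ps]]; apply: H Ps. Qed.

Lemma pdim_le_sub P Q : (forall v, P v -> Q v) -> (pdim P <= pdim Q)%N.
Proof. by move=> PQ; apply: pdim_leq => k s fs Ps; apply: leq_pdim fs _ => i; apply: PQ. Qed.

(** A free family satisfying [P] lies in the span of [X], whose dimension is at most the length of
    [X]. *)
Lemma pdim_le_span P (X : seq vT) :
  (forall v, P v -> v \in <<X>>%VS) -> (pdim P <= size X)%N.
Proof.
move=> PX; apply: pdim_leq => k s fs Ps.
rewrite -(size_tuple s) -(eqnP fs); apply: leq_trans (dim_span X); apply: dimvS.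
by apply/span_subvP => v /tnthP[i ->]; apply: PX.
Qed.

Lemma pdim0_eq0 P v : pdim P = 0%N -> P v -> v = 0.
Proof.
move=> P0 Pv; apply/eqP; apply: contraT => nz.
have: (1 <= pdim P)%N; last by rewrite P0.
by apply: (@leq_pdim P _ [tuple v]) => [|i]; rewrite ?seq1_free // ord1.
Qed.

Lemma pdim1_line P u v : pdim P = 1%N -> P u -> u != 0 -> P v -> exists c, v = c *: u.
Proof.
move=> P1 Pu nzu Pv; apply/vlineP; apply: contraT => nuv.
have: (2 <= pdim P)%N; last by rewrite P1.
apply: (@leq_pdim P _ [tuple v; u]) => [|i].
  by rewrite /= free_cons span_seq1 nuv seq1_free.
by rewrite (tnth_nth 0); case: i => [[|[|]]].
Qed.

End PropDimension.

(** * Morphisms, submodules and direct summands *)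

Section Modules.
Variables (F : closedFieldType) (V Ar : finType) (src tgt : Ar -> V).
Variable I : kQ F V Ar -> Prop.
Local Notation rep := (rep F V Ar).
Local Notation Amod := (is_Amod src tgt I).
Local Notation Bmod := (is_Bmod src tgt I).
Implicit Types M N K : rep.

Lemma is_homP M N (f : 'M_(rdim M, rdim N)) :
  is_hom f <-> forall k, gen M k *m f = f *m gen N k.
Proof.
split=> [[fE fX] [v|a] | H]; [exact: fE | exact: fX |].
by split=> [v|a]; [exact: (H (inl v)) | exact: (H (inr a))].
Qed.

Lemma is_hom1 M : @is_hom F V Ar M M 1%:M.
Proof. by apply/is_homP => k; rewrite mulmx1 mul1mx. Qed.

Lemma is_hom_comp M N K (f : 'M_(rdim M, rdim N)) (g : 'M_(rdim N, rdim K)) :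
  is_hom f -> is_hom g -> @is_hom F V Ar M K (f *m g).
Proof.
move=> /is_homP hf /is_homP hg; apply/is_homP => k.
by rewrite mulmxA hf -mulmxA hg mulmxA.
Qed.

Lemma act_hom M N (f : 'M_(rdim M, rdim N)) x :
  is_hom f -> act M x *m f = f *m act N x.
Proof.
case=> fE fX; rewrite /act mulmx_suml mulmx_sumr; apply: eq_bigr => -[c [v s]] _ /=.
rewrite -scalemxAl -scalemxAr; congr (_ *: _); rewrite /pact /=.
elim: s (rE M v) (rE N v) (fE v) => //= a s IHs A B AB.
by apply: IHs; rewrite -mulmxA fX mulmxA AB mulmxA.
Qed.

(** Row vectors are acted upon on the right, so [row_free f] means that [f] is injective. Each
    module equation for [M] can be checked after composing with [f], where it becomes one for
    [N]. *)
Lemma Amod_sub M N (f : 'M_(rdim M, rdim N)) :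
  is_hom f -> row_free f -> Amod N -> Amod M.
Proof.
move=> hf ff [[NE N1 NX] NI]; have [fE fX] := hf.
split; [split|].
- move=> v w; apply: (row_free_inj ff).
  rewrite -mulmxA fE mulmxA fE -mulmxA NE.
  by case: eqP => _; rewrite ?mulmx0 ?mul0mx ?fE.
- apply: (row_free_inj ff); rewrite mulmx_suml (eq_bigr (fun v => f *m rE N v)) //.
  by rewrite -mulmx_sumr N1 mulmx1 mul1mx.
- move=> a; apply: (row_free_inj ff).
  rewrite fX -!mulmxA fE [rX M a *m _]mulmxA fX !mulmxA fE -!mulmxA.
  by rewrite [rE _ _ *m _]mulmxA -NX.
- by move=> x Ix; apply: (row_free_inj ff); rewrite (act_hom x hf) NI // mulmx0 mul0mx.
Qed.

Lemma Bmod_sub M N (f : 'M_(rdim M, rdim N)) :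
  is_hom f -> row_free f -> Bmod N -> Bmod M.
Proof.
move=> hf ff [AN LN]; split; first exact: Amod_sub hf ff AN.
move=> a la; apply: (row_free_inj ff); case: hf => _ fX.
by rewrite fX LN // mulmx0 mul0mx.
Qed.

Lemma mx1_neq0 n : (0 < n)%N -> (1%:M : 'M[F]_n) != 0.
Proof. by move=> n0; rewrite -mxrank_eq0 mxrank1 -lt0n. Qed.

Lemma idempotent_split n (e : 'M[F]_n) : e *m e = e ->
  exists (i : 'M_(\rank e, n)) (p : 'M_(n, \rank e)), p *m i = e /\ i *m p = 1%:M.
Proof.
move=> ee; move: (row_base e) (col_base e) (row_base_free e) (col_base_full e) (mulmx_base e).
move=> i p /row_freeP[B iB] /row_fullP[C Cp] pi; exists i, p; split=> //.
(* Idempotence, between a left inverse of [p] and a right inverse of [i], reduces to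
   [i *m p = 1%:M]. *)
have : C *m (p *m i *m (p *m i)) *m B = C *m (p *m i) *m B by rewrite pi ee.
by rewrite !mulmxA Cp !mul1mx -[LHS]mulmxA iB mulmx1.
Qed.

(* The summand cut out by a nonzero idempotent endomorphism of minimal rank. *)
Lemma indecomposable_summand M : (0 < rdim M)%N ->
  exists K (i : 'M_(rdim K, rdim M)) (p : 'M_(rdim M, rdim K)),
    [/\ is_hom i, is_hom p, i *m p = 1%:M & indecomposable K].
Proof.
move=> M0.
pose P r := `[< exists e : 'M_(rdim M),
  [/\ @is_hom _ _ _ M M e, e *m e = e, e != 0 & \rank e = r] >].
have exP : exists r, P r.
  exists (\rank (1%:M : 'M[F]_(rdim M))); apply/asboolP; exists 1%:M.
  by split; [exact: is_hom1 | rewrite mulmx1 | exact: mx1_neq0 |].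
case: (ex_minnP exP) => r /asboolP[e [he ee nze re]] minr.
have [i [p [eE rc]]] := idempotent_split ee.
move/is_homP: he => he.
pose K := Rep (fun v => i *m rE M v *m p) (fun a => i *m rX M a *m p).
have genK k : gen K k = i *m gen M k *m p by case: k.
have ie : i *m e = i by rewrite -[X in _ *m X]eE mulmxA rc mul1mx.
have ep : e *m p = p by rewrite -[X in X *m _]eE -mulmxA rc mulmx1.
have hi : @is_hom _ _ _ K M i.
  apply/is_homP => k; rewrite genK -[X in X = _]mulmxA eE -[X in X = _]mulmxA he.
  by rewrite mulmxA ie.
have hp : @is_hom _ _ _ M K p.
  by apply/is_homP => k; rewrite genK !mulmxA eE -he -[X in _ = X]mulmxA ep.
exists K, i, p; split=> //; split=> /= [|f hf ff]; first by rewrite lt0n mxrank_eq0.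
have [-> | nzf] := eqVneq f 0; [by left | right].
(* The endomorphism [p *m f *m i] of [M] is again a nonzero idempotent. Minimality of [r] therefore
   gives [f] full rank, and an invertible idempotent is the identity. *)
have rk : (r <= \rank f)%N.
  apply: leq_trans (_ : \rank (p *m f *m i) <= _)%N; last first.
    by apply: leq_trans (mxrankM_maxl _ _) (mxrankM_maxr _ _).
  apply: minr; apply/asboolP; exists (p *m f *m i); split=> //.
  - exact: (is_hom_comp (is_hom_comp hp hf) hi).
  - by rewrite !mulmxA -[_ *m i *m p]mulmxA rc mulmx1 -[_ *m f *m f]mulmxA ff.
  - apply: contra nzf => /eqP z.
    have := congr1 (fun A => i *m A *m p) z.
    by rewrite mulmx0 mul0mx !mulmxA rc mul1mx -mulmxA rc mulmx1 => ->.
have uf : f \in unitmx by rewrite -row_free_unit /row_free eqn_leq rank_leq_row /= (leq_trans _ rk) ?re.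
by apply: (can_inj (mulKmx uf)); rewrite ff mulmx1.
Qed.

Lemma gen_ext_rep M N (D : {ffun V + Ar -> 'M_(rdim M, rdim N)}) k :
  gen (ext_rep D) k = block_mx (gen N k) 0 (D k) (gen M k).
Proof. by case: k. Qed.

(** * Extensions and their splittings *)

Section Extension.
Variables (M N : rep) (D : {ffun V + Ar -> 'M[F]_(rdim M, rdim N)}).
Local Notation E := (ext_rep D).

Definition ext_inj : 'M[F]_(rdim N, rdim E) := row_mx 1%:M 0.
Definition ext_proj : 'M[F]_(rdim E, rdim M) := col_mx 0 1%:M.

(** These are the coboundaries whose dimension is subtracted in [dimExt1]; they describe split
    extensions. *)
Definition inner_ext : Prop :=
  exists g : 'M[F]_(rdim M, rdim N), forall k, D k = g *m gen N k - gen M k *m g.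

Lemma ext_inj_hom : @is_hom _ _ _ N E ext_inj.
Proof.
apply/is_homP => k; rewrite gen_ext_rep /ext_inj mul_row_block mul_mx_row.
by rewrite !mulmx1 !mul1mx !mulmx0 !mul0mx !addr0.
Qed.

Lemma ext_proj_hom : @is_hom _ _ _ E M ext_proj.
Proof.
apply/is_homP => k; rewrite gen_ext_rep /ext_proj mul_block_col mul_col_mx.
by rewrite !mulmx1 !mul1mx !mulmx0 !mul0mx !add0r.
Qed.

Lemma inner_of_section (s : 'M_(rdim M, rdim E)) :
  is_hom s -> s *m ext_proj = 1%:M -> inner_ext.
Proof.
move=> /is_homP hs; rewrite -(hsubmxK s) /ext_proj mul_row_col mulmx0 add0r mulmx1 => s1.
(* The section is a row of blocks [l] and [1]. The left block of the morphism equation reads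
   [gen M k *m l = l *m gen N k + D k], hence the sign in [g = - l]. *)
exists (- lsubmx (s : 'M_(rdim M, rdim N + rdim M))) => k; have := hs k.
rewrite gen_ext_rep -(hsubmxK (s : 'M_(rdim M, rdim N + rdim M))) mul_row_block mul_mx_row.
move/eq_row_mx => [eqk _]; move: eqk; rewrite s1 row_mxKl mul1mx => eqk.
by rewrite mulmxN mulNmx opprK eqk addKr.
Qed.

Lemma inner_of_retraction (t : 'M_(rdim E, rdim N)) :
  is_hom t -> ext_inj *m t = 1%:M -> inner_ext.
Proof.
move=> /is_homP ht; rewrite -(vsubmxK t) /ext_inj mul_row_col mul0mx addr0 mul1mx => t1.
exists (dsubmx (t : 'M_(rdim N + rdim M, rdim N))) => k; have := ht k.
rewrite gen_ext_rep -(vsubmxK (t : 'M_(rdim N + rdim M, rdim N))) mul_block_col mul_col_mx.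
move/eq_col_mx => [_ eqk]; move: eqk; rewrite t1 col_mxKd mulmx1 => <-.
by rewrite addrK.
Qed.

(** Exactness at the middle term: [ext_inj] is a kernel of [ext_proj]. The factor is a morphism
    because [ext_inj] can be cancelled. *)
Lemma ext_inj_factor K (i : 'M_(rdim K, rdim E)) :
  is_hom i -> i *m ext_proj = 0 ->
  exists2 j : 'M_(rdim K, rdim N), is_hom j & j *m ext_inj = i.
Proof.
move=> /is_homP hi i0; pose j := lsubmx (i : 'M_(rdim K, rdim N + rdim M)).
have ji : j *m ext_inj = i.
  rewrite -[RHS](hsubmxK (i : 'M_(rdim K, rdim N + rdim M))) /ext_inj mul_mx_row mulmx1 mulmx0.
  congr row_mx; move: i0; rewrite -{1}(hsubmxK (i : 'M_(rdim K, rdim N + rdim M))).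
  by rewrite /ext_proj mul_row_col mulmx0 add0r mulmx1.
have /is_homP hinj := ext_inj_hom.
have inj_free : row_free ext_inj.
  by apply/row_freeP; exists (col_mx 1%:M 0); rewrite /ext_inj mul_row_col mulmx1 mulmx0 addr0.
exists j => //; apply/is_homP => k; apply: (row_free_inj inj_free).
by rewrite -mulmxA ji hi -[RHS]mulmxA hinj mulmxA ji.
Qed.

(** Dually, [ext_proj] is a cokernel of [ext_inj]. *)
Lemma ext_proj_factor K (p : 'M_(rdim E, rdim K)) :
  is_hom p -> ext_inj *m p = 0 ->
  exists2 q : 'M_(rdim M, rdim K), is_hom q & ext_proj *m q = p.
Proof.
move=> /is_homP hp p0; pose q := dsubmx (p : 'M_(rdim N + rdim M, rdim K)).
have qp : ext_proj *m q = p.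
  rewrite -[RHS](vsubmxK (p : 'M_(rdim N + rdim M, rdim K))) /ext_proj mul_col_mx mul1mx mul0mx.
  congr col_mx; move: p0; rewrite -{1}(vsubmxK (p : 'M_(rdim N + rdim M, rdim K))).
  by rewrite /ext_inj mul_row_col mul0mx addr0 mul1mx.
have /is_homP hproj := ext_proj_hom.
have proj_sec : row_mx 0 1%:M *m ext_proj = 1%:M.
  by rewrite /ext_proj mul_row_col mulmx1 mulmx0 add0r.
exists q => //; apply/is_homP => k.
rewrite -[LHS]mul1mx -[RHS]mul1mx -proj_sec -!mulmxA; congr (_ *m _).
by rewrite mulmxA -hproj -mulmxA qp hp -qp mulmxA.
Qed.

End Extension.

(** * Paths of indecomposable B-modules *)

Definition bstep M N : Prop :=
  [/\ Bmod M /\ indecomposable M, Bmod N /\ indecomposable N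
    & exists f : 'M_(rdim M, rdim N), [/\ is_hom f, f != 0 & ~ is_iso f]].

(** Unlike in [on_cycle], the morphisms stay hidden inside the steps, so paths can be concatenated
    without casts between matrix types. *)
Definition bpath M N : Prop :=
  exists (t : nat) (Ms : nat -> rep),
    [/\ (1 <= t)%N, Ms 0%N = M, Ms t = N
      & forall i, (i < t)%N -> bstep (Ms i) (Ms i.+1)].

Lemma bstep_path M N : bstep M N -> bpath M N.
Proof.
move=> MN; exists 1%N, (fun i => if i == 0%N then M else N); split=> //.
by case.
Qed.

Lemma bpath_trans M N K : bpath M N -> bpath N K -> bpath M K.
Proof.
move=> [t [Ms [t0 M0 Mt st]]] [u [Ns [u0 N0 Nu su]]].
exists (t + u)%N, (fun i => if (i < t)%N then Ms i else Ns (i - t)%N); split.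
- by rewrite addn_gt0 t0.
- by rewrite t0.
- by rewrite ltnNge leq_addr addKn.
- move=> i itu; case: (ltnP i t) => it; last first.
    by rewrite ltnNge (leqW it) /= subSn //; apply: su; rewrite ltn_subLR.
  case: ltnP => it'; first exact: st.
  have eqt : t = i.+1 by apply/eqP; rewrite eqn_leq it it'.
  by rewrite eqt subnn N0 -Mt {1}eqt; apply: st.
Qed.

Lemma bpath_on_cycle M : bpath M M -> on_cycle src tgt I M.
Proof.
move=> [t [Ms [t0 M0 Mt st]]].
have [fs fsP] : exists fs : forall i : nat, 'M[F]_(rdim (Ms i), rdim (Ms i.+1)),
    forall i, (i < t)%N -> [/\ is_hom (fs i), fs i != 0 & ~ is_iso (fs i)].
  have fP i : exists f : 'M[F]_(rdim (Ms i), rdim (Ms i.+1)),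
      (i < t)%N -> [/\ is_hom f, f != 0 & ~ is_iso f].
    (* Past the end of the path the zero matrix serves as a filler. *)
    have [it|it] := ltnP i t; last by exists 0.
    by have [_ _ [f fP]] := st i it; exists f.
  by exists (fun i => sval (cid (fP i))) => i; exact: (svalP (cid (fP i))).
exists t, Ms, fs; split=> //.
- move=> i; rewrite leq_eqVlt => /orP[/eqP-> | /st[] //].
  by have [|_] := st t.-1; rewrite ?ltn_predL ?prednK.
- rewrite M0 Mt; exists 1%:M; split; first exact: is_hom1.
  by exists 1%:M; [exact: is_hom1 | rewrite mulmx1].
- by exists 0%N.
Qed.

(* Any indecomposable summand K of the middle term works: if one of the two
   maps were zero or invertible, the extension would split. *)
Lemma nonsplit_bpath M N (D : {ffun V + Ar -> 'M_(rdim M, rdim N)}) :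
  Bmod (ext_rep D) -> Bmod M /\ indecomposable M -> Bmod N /\ indecomposable N ->
  ~ inner_ext D -> bpath N M.
Proof.
move=> BE BM BN ninn; have [_ [M0 idM]] := BM; have [_ [_ idN]] := BN.
have [|K [i [p [hi hp ip idK]]]] := @indecomposable_summand (ext_rep D).
  by rewrite addn_gt0 M0 orbT.
have BK : Bmod K by apply: Bmod_sub hi _ BE; apply/row_freeP; exists p.
have [K0 _] := idK.
have hinj := ext_inj_hom D; have hproj := ext_proj_hom D.
have hNK := is_hom_comp hinj hp; have hKM := is_hom_comp hi hproj.
apply: (@bpath_trans _ K); apply: bstep_path; split=> //.
- exists (ext_inj D *m p); split=> //.
    (* If the map from [N] to [K] were zero, [p] would factor through the projection and [K] would
       be a summand of [M]. Since [M] is indecomposable, the idempotent is 0, which kills [K], or 1,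
       which makes [q *m i] a section. *)
    apply/eqP => p0; have [q hq qp] := ext_proj_factor hp p0.
    have iqq : i *m ext_proj D *m q = 1%:M by rewrite -mulmxA qp.
    case: (idM (q *m (i *m ext_proj D))) => [||e0|e1].
    + exact: is_hom_comp.
    + by rewrite -[LHS]mulmxA [X in q *m X]mulmxA iqq mul1mx.
    + move/eqP: (mx1_neq0 K0); apply; rewrite -iqq -[LHS]mulmx1 -iqq.
      by rewrite -[LHS]mulmxA (mulmxA q) e0 mul0mx mulmx0.
    + apply: ninn; apply: (@inner_of_section _ _ _ (q *m i)); first exact: is_hom_comp.
      by rewrite -mulmxA.
  move=> [_ [h hh [e1 _]]]; apply: ninn.
  by apply: (@inner_of_retraction _ _ _ (p *m h)); [exact: is_hom_comp | rewrite mulmxA].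
- exists (i *m ext_proj D); split=> //.
    (* Dually, [K] would be a summand of [N], and [p *m j] a retraction. *)
    apply/eqP => i0; have [j hj ji] := ext_inj_factor hi i0.
    have jjp : j *m (ext_inj D *m p) = 1%:M by rewrite mulmxA ji.
    case: (idN (ext_inj D *m p *m j)) => [||e0|e1].
    + exact: is_hom_comp.
    + by rewrite -[LHS]mulmxA (mulmxA j) jjp mul1mx.
    + move/eqP: (mx1_neq0 K0); apply; rewrite -jjp -[LHS]mul1mx -jjp.
      by rewrite -[LHS]mulmxA (mulmxA _ j) e0 mul0mx mulmx0.
    + apply: ninn; apply: (@inner_of_retraction _ _ _ (p *m j)); first exact: is_hom_comp.
      by rewrite mulmxA.
  move=> [_ [h hh [_ e1]]]; apply: ninn.
  by apply: (@inner_of_section _ _ _ (h *m i)); [exact: is_hom_comp | rewrite -mulmxA].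
Qed.

(** * Products of idempotents and arrows in a module *)

Section KQmod.
Variable M : rep.
Hypothesis kM : is_kQmod src tgt M.

Lemma idem_mul_arrow v a : rE M v *m rX M a = if v == src a then rX M a else 0.
Proof.
have [EE _ EX] := kM; rewrite EX !mulmxA EE.
by case: eqP => [->|_]; rewrite ?mul0mx.
Qed.

Lemma arrow_mul_idem v a : rX M a *m rE M v = if v == tgt a then rX M a else 0.
Proof.
have [EE _ EX] := kM; rewrite EX -mulmxA EE [_ == v]eq_sym.
by case: eqP => [_|_]; rewrite ?mulmx0.
Qed.

Lemma arrow_mul_arrow0 a b : tgt a != src b -> rX M a *m rX M b = 0.
Proof.
move=> ab; have [_ _ EX] := kM.
by rewrite (EX b) !mulmxA arrow_mul_idem eq_sym (negPf ab) !mul0mx.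
Qed.

Lemma pact2 a b : pact M (src a, [:: a; b]) = rX M a *m rX M b.
Proof. by rewrite /pact /= idem_mul_arrow eqxx. Qed.

End KQmod.

(** * Action of the loops *)

Hypothesis adm : admissible src tgt I.
Hypothesis lcomm : loop_comm src tgt I.

(** Composable products with a non-loop vanish by the first two loop relations, loops at the same
    vertex commute by the third, and products of non-composable arrows are zero. *)
Lemma loop_endomorphism M g : Amod M -> is_loop src tgt g -> @is_hom _ _ _ M M (rX M g).
Proof.
move=> [kM MI] lg; have [LA LB LC] := lcomm; have st : src g = tgt g by exact/eqP.
split=> [v|a].
  by rewrite (idem_mul_arrow kM) (arrow_mul_idem kM) st.
have [la|nla] := boolP (is_loop src tgt a); last first.
  have -> : rX M a *m rX M g = 0.
    have [ag|] := eqVneq (tgt a) (src g); last exact: arrow_mul_arrow0.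
    by have := MI _ (LB _ _ nla lg ag); rewrite /act big_seq1 scale1r pact2.
  have [ga|/arrow_mul_arrow0->//] := eqVneq (tgt g) (src a).
  by have := MI _ (LA _ _ lg nla ga); rewrite /act big_seq1 scale1r pact2.
have sta : src a = tgt a by exact/eqP.
have [ag|nag] := eqVneq (src a) (src g); last first.
  by rewrite !arrow_mul_arrow0 // -?st -?sta // eq_sym.
have := MI _ (LC _ _ la lg ag); rewrite /act big_cons big_seq1 /= scale1r scaleN1r.
by rewrite pact2 // ag pact2 // => /subr0_eq.
Qed.

(** Loops kill [M] and [N], so a loop acts on the middle term by its lower left block alone. The
    lower left block of the commutation with a generator is then the morphism equation. *)
Lemma ext_loop_hom M N (D : {ffun V + Ar -> 'M_(rdim M, rdim N)}) g :
  Bmod M -> Bmod N -> Amod (ext_rep D) -> is_loop src tgt g ->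
  @is_hom _ _ _ M N (D (inr g)).
Proof.
move=> [_ LM] [_ LN] AE lg; have /is_homP H := loop_endomorphism AE lg.
apply/is_homP => k; have := H k.
rewrite gen_ext_rep /= (LM g lg) (LN g lg) !mulmx_block !mulmx0 !mul0mx !addr0 add0r.
by move/eq_block_mx => [_ _ ].
Qed.

Lemma scalar_loop_eq0 M g c :
  Amod M -> (0 < rdim M)%N -> is_loop src tgt g -> rX M g = c *: 1%:M -> c = 0.
Proof.
move=> [kM MI] M0 lg gc; apply/eqP; apply: contraT => nzc.
have [_ [m _ Im] _] := adm.
have /MI : I (pathkQ F (src g, nseq m g)).
  apply: Im; last by rewrite /plen size_nseq.
  rewrite /valid /=; elim: (m) => //= k IHk.
  by rewrite eqxx -(eqP lg).
rewrite /act big_seq1 scale1r /pact /=.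
(* Cancelling the nonzero [c] in [rE M (src g) *m rX M g = rX M g]; the path of [m] copies of [g]
   then acts as [c ^+ m]. *)
have E1 : rE M (src g) = 1%:M.
  have := idem_mul_arrow kM (src g) g; rewrite eqxx gc -scalemxAr mulmx1.
  exact: scalerI.
have -> : foldl (fun A a => A *m rX M a) (rE M (src g)) (nseq m g) = c ^+ m *: 1%:M.
  rewrite E1 -[X in foldl _ X _]scale1r -[X in X *: _](expr0 c) -{2}[m]add0n.
  elim: (m) 0%N => [|j IHj] k /=; first by rewrite addn0.
  by rewrite gc -scalemxAr mulmx1 scalerA -exprS IHj addnS addSn.
move/eqP; rewrite scaler_eq0 expf_eq0 (negPf nzc) andbF /=.
by rewrite (negPf (mx1_neq0 M0)).
Qed.

(** * Extensions inside a brick set *)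

Section BrickSet.
Variables (n : nat) (X : 'I_n -> rep).
Hypothesis brX : brick_set src tgt I X.

Lemma brick_endo_scalar i (f : 'M_(rdim (X i))) :
  @is_hom _ _ _ (X i) (X i) f -> exists c, f = c *: 1%:M.
Proof.
have [_ X0] := brX i i; rewrite eqxx => /pdim1_line H hf.
by apply: H hf; [exact: is_hom1 | exact: mx1_neq0].
Qed.

Lemma brick_hom_eq0 i j (f : 'M_(rdim (X i), rdim (X j))) : i != j -> is_hom f -> f = 0.
Proof. by move=> ij; have [_ _] := brX i j; rewrite (negPf ij) => /pdim0_eq0; apply. Qed.

Lemma brick_indecomposable i : indecomposable (X i).
Proof.
have [_ X0 _] := brX i i; split=> // e /brick_endo_scalar[c ->].
rewrite -scalemxAl mul1mx scalerA => /eqP; rewrite -subr_eq0 -scalerBl scaler_eq0.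
rewrite (negPf (mx1_neq0 X0)) orbF -{3}[c]mulr1 -mulrBr mulf_eq0 subr_eq0.
by case/orP => /eqP->; [left; rewrite scale0r | right; rewrite scale1r].
Qed.

Lemma brick_Bmod i : Bmod (X i).
Proof.
have [AX X0 _] := brX i i; split=> // g lg.
have [c gc] := brick_endo_scalar (loop_endomorphism AX lg).
by rewrite gc (scalar_loop_eq0 AX X0 lg gc) scale0r.
Qed.

Let BI i : Bmod (X i) /\ indecomposable (X i).
Proof. by split; [exact: brick_Bmod | exact: brick_indecomposable]. Qed.

(** When the loop components vanish, every middle term is a B-module. Without a path each extension
    is then inner by [nonsplit_bpath], and the difference defining [dimExt1] is zero. *)
Lemma dimExt1_bpath i j :
  (forall D : {ffun V + Ar -> 'M_(rdim (X i), rdim (X j))},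
     Amod (ext_rep D) -> forall g, is_loop src tgt g -> D (inr g) = 0) ->
  dimExt1 src tgt I (X i) (X j) != 0%N -> bpath (X j) (X i).
Proof.
move=> noloop; apply: contra_neqP => npath; apply/eqP; rewrite subn_eq0.
apply: pdim_le_sub => D AD; apply: contra_notP npath => ninn.
apply: (@nonsplit_bpath _ _ D) => //; split=> // g lg.
have [_ Li] := brick_Bmod i; have [_ Lj] := brick_Bmod j.
by rewrite /= Li // Lj // noloop // block_mx0.
Qed.

Lemma dimExt1_offdiag_bpath i j : i != j ->
  dimExt1 src tgt I (X i) (X j) != 0%N -> bpath (X j) (X i).
Proof.
move=> ij; apply: dimExt1_bpath => D AD g lg.
exact: brick_hom_eq0 ij (ext_loop_hom (brick_Bmod i) (brick_Bmod j) AD lg).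
Qed.

(* A self-extension is determined by the scalars on the loops at P. *)
Lemma dimExt1_le_nloops i P : rE (X i) P = 1%:M ->
  (dimExt1 src tgt I (X i) (X i) <= nloops src tgt P)%N.
Proof.
move=> EP; set L := [set a | (src a == P) && (tgt a == P)].
have [[[EE _ _] _] _ _] := brX i i.
have E0 v : v != P -> rE (X i) v = 0.
  by move=> vP; have := EE v P; rewrite (negPf vP) EP mulmx1.
pose d a : {ffun V + Ar -> 'M[F]_(rdim (X i))} :=
  [ffun k => if k == inr a then 1%:M else 0].
apply: leq_trans (leq_subr _ _) _; rewrite /nloops cardE -(size_map d).
apply: pdim_le_span => D AD.
have [[DE _ DX] _] := AD.
(* Idempotence of the action of [P] on the middle term gives [D (inl P) + D (inl P) = D (inl P)];
   orthogonality to [P] then settles the other vertices. *)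
have DP : D (inl P) = 0.
  have := DE P P; rewrite eqxx /= EP mulmx_block !mulmx1 !mul1mx mul0mx mulmx0.
  by move/eq_block_mx => [_ _ DD _]; apply: (addrI (D (inl P))); rewrite DD addr0.
have D0 v : D (inl v) = 0.
  have [-> // | vP] := eqVneq v P.
  have := DE v P; rewrite (negPf vP) /= EP DP mulmx_block !mulmx1 !mulmx0 !addr0.
  by rewrite -[0 in RHS]block_mx0 => /eq_block_mx [_ _ ].
have D0a a : a \notin L -> D (inr a) = 0.
  have Ev0 v : v != P -> rE (ext_rep D) v = 0 by move=> /E0 vP; rewrite /= vP D0 block_mx0.
  rewrite inE negb_and => aL; have := DX a.
  have -> : rE (ext_rep D) (src a) *m rX (ext_rep D) a *m rE (ext_rep D) (tgt a) = 0.
    by case/orP: aL => /Ev0 ->; rewrite ?mul0mx ?mulmx0.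
  by rewrite /= -[0 in RHS]block_mx0 => /eq_block_mx [_ _ ].
have /choice[c cP] : forall a, exists c : F, a \in L -> D (inr a) = c *: 1%:M.
  move=> a; have [aL|_] := boolP (a \in L); last by exists 0.
  have la : is_loop src tgt a by move: aL; rewrite inE /is_loop => /andP[/eqP-> /eqP->].
  have [c cP] := brick_endo_scalar (ext_loop_hom (brick_Bmod i) (brick_Bmod i) AD la).
  by exists c.
have -> : D = \sum_(a in L) c a *: d a.
  apply/ffunP => -[v|b]; rewrite sum_ffunE.
    by rewrite D0 big1 // => a _; rewrite !ffunE scaler0.
  have [bL|bL] := boolP (b \in L).
    rewrite (bigD1 b) //= !ffunE eqxx cP // big1 ?addr0 // => a /andP[_ ab].
    by rewrite !ffunE (inj_eq inr_inj) eq_sym (negPf ab) scaler0.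
  rewrite D0a // big1 // => a aL; rewrite !ffunE.
  case: eqP => [[ba]|_]; last by rewrite scaler0.
  by rewrite ba aL in bL.
apply: memv_suml => a aL; apply/memvZ/memv_span/map_f.
by rewrite mem_enum.
Qed.

Hypothesis dirB : rep_directed_B src tgt I.

Lemma bpath_acyclic i j : bpath (X i) (X j) -> bpath (X j) (X i) -> False.
Proof.
move=> ij ji; have [Bi Ii] := BI i.
by apply: (dirB Bi Ii); apply: bpath_on_cycle; exact: bpath_trans ij ji.
Qed.

(** If no self-extension involves a loop, a nonzero Ext gives a path from [X i] to itself, against
    directedness. Otherwise some loop [g] has a nonzero scalar component, which forces [src g] to
    act as the identity. *)
Lemma dimExt1_diag i :
  (dimExt1 src tgt I (X i) (X i) <= \max_(P : V) nloops src tgt P)%N.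
Proof.
have [->// | nz] := eqVneq (dimExt1 src tgt I (X i) (X i)) 0%N.
have [noloop|] := pselect (forall D : {ffun V + Ar -> 'M_(rdim (X i))},
  Amod (ext_rep D) -> forall g, is_loop src tgt g -> D (inr g) = 0).
  by have ii := dimExt1_bpath noloop nz; case: (bpath_acyclic ii ii).
move=> /existsNP[D /not_implyP[AD /existsNP[g /not_implyP[lg /eqP nzD]]]].
apply: leq_trans (leq_bigmax (src g)); apply: dimExt1_le_nloops.
have [c Dc] := brick_endo_scalar (ext_loop_hom (brick_Bmod i) (brick_Bmod i) AD lg).
have [[kE _] [_ Li]] := (AD, brick_Bmod i).
have := idem_mul_arrow kE (src g) g; rewrite eqxx /= Li // mulmx_block.
rewrite !mulmx0 !add0r => /eq_block_mx [_ _ + _]; rewrite Dc -scalemxAr mulmx1.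
apply: scalerI; apply: contraNneq nzD => c0.
by rewrite Dc c0 scale0r.
Qed.

End BrickSet.

(** * The lower bound from simple modules *)

Definition short_path (k : V + Ar) : qpath V Ar :=
  match k with inl v => (v, [::]) | inr a => (src a, [:: a]) end.

(** Only the paths of length at most one, listed by [short_path], act nontrivially, and
    admissibility makes their coefficients vanish on [I]. *)
Lemma rad_square_zero_Amod M : is_kQmod src tgt M ->
  (forall a b, rX M a *m rX M b = 0) -> Amod M.
Proof.
move=> kM XX; split=> // x Ix; have [_ _ Ishort] := adm.
have pactE p : pact M p = \sum_(k | p == short_path k) pact M (short_path k).
  case: p => v [|a [|b s]].
  - rewrite (big_pred1 (inl v)) // => -[w|b] //=; last by rewrite xpair_eqE andbF.
    by rewrite xpair_eqE andbT eq_sym.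
  - have [->|nav] := eqVneq v (src a).
      rewrite (big_pred1 (inr a)) // => -[w|b] //=; first by rewrite xpair_eqE andbF.
      rewrite xpair_eqE eqseq_cons andbT (inj_eq inr_inj) [b == a]eq_sym.
      by case: (eqVneq a b) => [->|_]; rewrite ?eqxx ?andbF.
    (* Formal combinations may contain an arrow paired with a wrong start vertex; such a pair is no
       [short_path] and acts as zero. *)
    rewrite {1}/pact /= (idem_mul_arrow kM) (negPf nav) big1 // => -[w|b] /eqP[] //.
    by move=> vb ab; rewrite vb ab eqxx in nav.
  - rewrite {1}/pact /= -[_ *m rX M a *m _]mulmxA XX mulmx0 big1; last by case=> [w|c] /eqP[].
    by elim: s => //= c s IHs; rewrite mul0mx.
rewrite /act (eq_bigr (fun cp => \sum_(k | cp.2 == short_path k) cp.1 *: pact M (short_path k))).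
  rewrite (exchange_big_dep xpredT) //= big1 // => k _.
  rewrite -scaler_suml -[X in X *: _]/(coef x (short_path k)) Ishort ?scale0r //.
    by case: k => [v|a]; rewrite /valid //= eqxx.
  by case: k.
by move=> cp _; rewrite pactE scaler_sumr.
Qed.

Definition loops_at P := [set a | (src a == P) && (tgt a == P)].

Lemma point_kQmod M P : (forall v, rE M v = (v == P)%:R%:M) ->
  (forall a, a \notin loops_at P -> rX M a = 0) -> is_kQmod src tgt M.
Proof.
move=> ME MX; split.
- move=> v w; rewrite !ME -scalar_mxM; have [->|vw] := eqVneq v w.
    by case: eqP => _; rewrite ?mulr1 ?mulr0.
  case: (eqVneq v P) => [vP|_]; last by rewrite mul0r -scalemx1 scale0r.
  by rewrite -vP eq_sym (negPf vw) mulr0 -scalemx1 scale0r.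
- rewrite (bigD1 P) //= ME eqxx big1 ?addr0 // => v vP.
  by rewrite ME (negPf vP) -scalemx1 scale0r.
- move=> a; have [|aL] := boolP (a \in loops_at P).
    by rewrite inE !ME => /andP[-> ->]; rewrite mul1mx mulmx1.
  by rewrite MX // mulmx0 mul0mx.
Qed.

Definition simple_rep (P : V) : rep :=
  @Rep F V Ar 1 (fun v => (v == P)%:R%:M) (fun _ => 0).

Lemma simple_rep_Amod P : Amod (simple_rep P).
Proof.
by apply: rad_square_zero_Amod => [|a b]; [exact: point_kQmod | rewrite /= mulmx0].
Qed.

(** Strictly lower triangular blocks multiply to zero, so the scalars on the loops at [P] can be
    chosen freely. *)
Lemma simple_ext_Amod P (D : {ffun V + Ar -> 'M[F]_1}) :
  (forall v, D (inl v) = 0) -> (forall a, a \notin loops_at P -> D (inr a) = 0) ->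
  Amod (@ext_rep F V Ar (simple_rep P) (simple_rep P) D).
Proof.
move=> DE DX; apply: rad_square_zero_Amod => [|a b].
  apply: point_kQmod => [v|a /DX] /=; first by rewrite DE -scalar_mx_block.
  by move=> ->; rewrite block_mx0.
by rewrite /= mulmx_block !mulmx0 !mul0mx !addr0 block_mx0.
Qed.

Lemma simple_rep_brick P : brick_set src tgt I (fun _ : 'I_1 => simple_rep P).
Proof.
move=> i j; rewrite !ord1 eqxx; split=> //; first exact: simple_rep_Amod.
apply/eqP; rewrite eqn_leq; apply/andP; split.
  apply: (@pdim_le_span _ _ _ [:: 1%:M]) => f _.
  by rewrite span_seq1; apply/vlineP; exists (f 0 0); rewrite scalemx1 -mx11_scalar.
apply: (@leq_pdim _ _ _ _ [tuple 1%:M]); first by rewrite seq1_free mx1_neq0.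
by move=> k; rewrite ord1; exact: (is_hom1 (simple_rep P)).
Qed.

Lemma nloops_le_dimExt1_simple P :
  (nloops src tgt P <= dimExt1 src tgt I (simple_rep P) (simple_rep P))%N.
Proof.
rewrite /dimExt1; set p := pdim _; set inn := pdim _.
(* Arrows act as zero and vertices as scalars on the simple module, so every coboundary vanishes. *)
have -> : inn = 0%N.
  apply/eqP; rewrite -leqn0; apply: (@pdim_le_span _ _ _ [::]) => D [g Dg].
  suff -> : D = 0 by rewrite mem0v.
  apply/ffunP => -[v|a]; rewrite Dg ffunE /=; last by rewrite mulmx0 mul0mx subrr.
  by rewrite scalar_mxC subrr.
rewrite subn0 /p /nloops -/(loops_at P).
pose d a : {ffun V + Ar -> 'M[F]_1} := [ffun k => if k == inr a then 1%:M else 0].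
apply: (@leq_pdim _ _ _ _ [tuple d (enum_val i) | i < #|loops_at P|]).
  apply/freeP => c c0 j.
  have := congr1 (fun D : {ffun V + Ar -> 'M[F]_1} => D (inr (enum_val j))) c0.
  rewrite sum_ffunE (bigD1 j) // big1 => [|i /andP[_ ij]].
    rewrite [LHS]addr0 ffunE -tnth_nth tnth_mktuple !ffunE eqxx => /eqP.
    by rewrite scaler_eq0 (negPf (mx1_neq0 _)) // orbF => /eqP.
  rewrite ffunE -tnth_nth tnth_mktuple ffunE (inj_eq inr_inj) (inj_eq enum_val_inj) eq_sym.
  by rewrite (negPf ij) scaler0.
move=> i; rewrite tnth_mktuple; apply: simple_ext_Amod => [v|a aL]; rewrite ffunE //.
case: eqP => [[ai]|//]; move: aL; rewrite ai.
by rewrite enum_valP.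
Qed.

End Modules.

(** * Spectral radius and eigenvalues *)

Lemma char_poly_roots n (C : 'M[algC]_n) z :
  (z \in sval (closed_field_poly_normal (char_poly C))) = eigenvalue C z.
Proof.
rewrite eigenvalue_root_char; case: closed_field_poly_normal => /= r.
by rewrite (monicP (char_poly_monic C)) scale1r => ->; rewrite root_prod_XsubC.
Qed.

Lemma specrad_le n (C : 'M[algC]_n) x : 0 <= x ->
  (forall z, eigenvalue C z -> `|z| <= x) -> specrad C <= x.
Proof.
move=> x0 Cx; rewrite /specrad.
have: forall z, z \in sval (closed_field_poly_normal (char_poly C)) -> `|z| <= x.
  by move=> z; rewrite char_poly_roots; apply: Cx.
elim: (sval _) => //= z s IHs zx; rewrite /cmax.
case: ifP => _; last by apply: zx; rewrite mem_head.
by apply: IHs => y ys; apply: zx; rewrite inE ys orbT.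
Qed.

Lemma specrad_ge n (C : 'M[algC]_n) z : eigenvalue C z -> `|z| <= specrad C.
Proof.
rewrite -char_poly_roots /specrad; elim: (sval _) => //= y s IHs.
set f := foldr _ _ _ in IHs *.
have f0 : 0 <= f.
  by rewrite /f; elim: s {IHs f} => //= u s IHs; rewrite /cmax; case: ifP.
(* The order on [algC] is partial; [cmax] is a true maximum here because both arguments are real. *)
have yf : (`|y| <= f) || (f <= `|y|) by apply: real_leVge; apply: ger0_real.
rewrite inE /cmax => /orP[/eqP-> | /IHs zf]; case: ifP => // yf'.
by apply: le_trans zf _; move: yf; rewrite yf'.
Qed.

(* At a source j of the support of an eigenvector, the eigenvalue equation
   reads z v_j = v_j C_jj. *)
Lemma eigenvalue_acyclic (K : fieldType) n (C : 'M[K]_n) z :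
  let e := [rel i j | (i != j) && (C i j != 0)] in
  (forall i j, e i j -> ~~ connect e j i) ->
  eigenvalue C z -> exists j, z = C j j.
Proof.
move=> e acyc /eigenvalueP[v vC /rV0Pn[j0 vj0]].
(* Minimising the number of vertices that reach [j] over the support yields a source: an edge from a
   supported [i] to [j] would give [i] strictly fewer, as [j] does not reach [i]. *)
pose w j := #|[set i | connect e i j]|.
case: (@arg_minnP _ j0 (fun j => v 0 j != 0) w vj0) => j vj minj.
exists j; apply: (mulIf vj); have := congr1 (fun A : 'rV_n => A 0 j) vC.
rewrite !mxE (bigD1 j) //= big1 ?addr0 => [<-|i ij]; first by rewrite mulrC.
apply/eqP; rewrite mulf_eq0 -implyNb; apply/implyP => vi; apply: contraT => Cij.
have eij : e i j by rewrite /= ij Cij.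
have /= := minj i vi; rewrite leqNgt => /negP[]; apply: proper_card.
apply/properP; split.
  by apply/subsetP => k; rewrite !inE => ki; apply: (connect_trans ki); apply: connect1.
by exists j; rewrite !inE ?connect0 // acyc.
Qed.

Theorem theorem4p1 (F : closedFieldType) (V Ar : finType) (src tgt : Ar -> V)
    (I : kQ F V Ar -> Prop) :
  connected_quiver src tgt ->
  admissible src tgt I ->
  loop_comm src tgt I ->
  rep_directed_B src tgt I ->
  is_fpdim_Amod src tgt I ((\max_(P : V) nloops src tgt P)%:R).
Proof.
move=> _ adm lcomm dirB; split; first exact: ler0n.
- move=> n X brX; apply: specrad_le => [|z]; first exact: ler0n.
  have brP i j : (i != j) && (adjmx src tgt I X i j != 0) ->
      bpath src tgt I (X j) (X i).
    rewrite mxE pnatr_eq0 => /andP[ij]; exact: dimExt1_offdiag_bpath.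
  case/eigenvalue_acyclic => [i j eij|j ->]; last first.
    by rewrite mxE normr_nat ler_nat dimExt1_diag.
  have ji := brP i j eij; apply/negP => /connectP[p pth ilast].
  (* Edges of the matrix and paths of modules run in opposite directions, so a walk from [j] to [i]
     yields a path from [X i] to [X j], which closes a cycle with [ji]. *)
  have: i = j \/ bpath src tgt I (X i) (X j).
    move: pth ilast; elim: p j {eij ji} => [|k p IHp] j /=; first by left.
    move=> /andP[jk pk] ik; right; have kj := brP j k jk.
    by case: (IHp k pk ik) => [->//|ik']; apply: bpath_trans ik' kj.
  case=> [ij|ij]; first by move: eij; rewrite ij /= eqxx.
  exact: (bpath_acyclic adm lcomm brX dirB) ij ji.
- move=> y y0 ub; have lb P : (nloops src tgt P)%:R <= y.
    have brP := simple_rep_brick adm P; apply: le_trans (ub _ _ brP).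
    set C := adjmx _ _ _ _; set S := simple_rep F Ar P.
    apply: le_trans (_ : (dimExt1 src tgt I S S)%:R <= _).
      by rewrite ler_nat nloops_le_dimExt1_simple.
    (* The brick set has one element, so the only entry of the 1 by 1 matrix is its eigenvalue. *)
    rewrite -[X in X <= _]normr_nat; apply: specrad_ge; apply/eigenvalueP.
    exists 1%:M; last exact: matrix_nonzero1.
    by rewrite mul1mx scalemx1 [C]mx11_scalar mxE.
  (* The base case, the default value 0 of the maximum, is the hypothesis [y0]. *)
  by elim/big_ind: _ => // m k my ky; rewrite /maxn; case: ifP.
Qed.
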